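(* Let $F(s)=C(sI_n-A)^{-1}B+D$ be an $m\times m$-valued rational function with realization array $R_F=\begin{pmatrix}A&B\\ C&D\end{pmatrix}$ of size $(n+m)\times(n+m)$. (i) If there exist a matrix $T$ with $I_m\succ T\succcurlyeq 0$, $\mathrm{rank}(T)\ge 1$, and a positive definite $n\times n$ matrix $H$ such that $$\begin{pmatrix}-H&0\\0&I_m\end{pmatrix}R_F+R_F^*\begin{pmatrix}-H&0\\0&I_m\end{pmatrix}=\begin{pmatrix}C&D\\0_{m\times n}&I_m\end{pmatrix}^*\begin{pmatrix}T&0\\0&T\end{pmatrix}\begin{pmatrix}C&D\\0_{m\times n}&I_m\end{pmatrix},\qquad(\ast)$$ then $F(s)$ is a canonical $\mathcal{HP}_T$ function. If the realization is minimal, the converse is true as well (that is, if $F$ is a canonical $\mathcal{HP}_T$ function then there exists a positive definite $H$ such that $(\ast)$ holds). (ii) With a non-singular $R_F$ satisfying $(\ast)$ as in (i), let $R_{\hat F}:=R_F^{-1}$, and let $\hat F(s)$ be the $m\times m$-valued rational function whose realization array is $R_{\hat F}$. Then $\hat F(s)$ is another canonical $\mathcal{HP}_T$ function, with the same $T$.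
   Context: $\mathbb{C}_R$ denotes the open right half of the complex plane, $\succcurlyeq$ ($\succ$) the positive semidefinite (positive definite) order on Hermitian matrices, and $^*$ the conjugate transpose. For $I_m\succ T\succcurlyeq 0$, an $m\times m$-valued rational function $F(s)$ is in $\mathcal{HP}_T$ ($T$-Hyper-Positive) if $F(s)+F(s)^*\succcurlyeq T+F(s)^*TF(s)$ for all $s\in\mathbb{C}_R$. It is a canonical $\mathcal{HP}_T$ function if, in addition, $F(s)+F(s)^*-\big(T+F(s)^*TF(s)\big)=0$ for all $s\in i\mathbb{R}$. An array $R=\begin{pmatrix}A&B\\C&D\end{pmatrix}$, with $A$ of size $n\times n$ and $D$ of size $m\times m$, is a realization of the function $C(sI_n-A)^{-1}B+D$ ($R_{\hat F}$ is partitioned in the same way); it is minimal if $n$ is the smallest possible for that function. *)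

(* Defs.v *)
From HB Require Import structures.
From mathcomp Require Import all_boot all_order all_algebra.
From mathcomp Require Import complex reals.

Set Implicit Arguments.
Unset Strict Implicit.
Unset Printing Implicit Defensive.

Import Order.TTheory GRing.Theory Num.Theory.
Local Open Scope ring_scope.
Local Open Scope sesquilinear_scope.

Section LoewnerOrder.
Variables (C : numClosedFieldType) (n : nat).
Implicit Types M N : 'M[C]_n.

(* In a numClosedFieldType, 0 <= z entails that z is real. *)
Definition psdmx M : Prop :=
  M \is hermsymmx /\ forall x : 'cV[C]_n, 0 <= (x^t* *m M *m x) 0 0.

Definition pdmx M : Prop :=
  M \is hermsymmx /\ forall x : 'cV[C]_n, x != 0 -> 0 < (x^t* *m M *m x) 0 0.

Definition loewner_ge M N : Prop := psdmx (M - N).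
Definition loewner_gt M N : Prop := pdmx (M - N).

End LoewnerOrder.

Section RationalFunctions.
Variable C : numClosedFieldType.

(* f is regular at s with value v: some fraction representing f has a
   denominator that does not vanish at s.  At a pole there is no such v. *)
Definition has_value (f : {fraction {poly C}}) (s v : C) : Prop :=
  exists p q : {poly C},
    [/\ q.[s] != 0, f = tofrac p / tofrac q & v = p.[s] / q.[s]].

Lemma has_value_uniq f s v w : has_value f s v -> has_value f s w -> v = w.
Proof.
move=> [p [q [qs0 -> ->]]] [p' [q' [q's0 + ->]]].
have nz (r : {poly C}) : r.[s] != 0 -> tofrac r != 0.
  by apply: contraNneq => /eqP; rewrite tofrac_eq0 => /eqP ->; rewrite horner0.
move=> /eqP; rewrite eqr_div ?nz // -!tofracM tofrac_eq => /eqP E.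
by apply/eqP; rewrite eqr_div // -!hornerM E.
Qed.

Definition mx_has_value m (F : 'M[{fraction {poly C}}]_m) (s : C) (V : 'M[C]_m)
  : Prop := forall i j, has_value (F i j) s (V i j).

(* C (s I_n - A)^-1 B + D over the field of rational functions; there
   s I_n - A, the characteristic matrix of A, is always invertible. *)
Definition transfer n m (R : 'M[C]_(n + m)) : 'M[{fraction {poly C}}]_m :=
  let cst p q (M : 'M[C]_(p, q)) : 'M[{fraction {poly C}}]_(p, q) :=
    map_mx (fun c : C => tofrac c%:P) M in
  cst _ _ (dlsubmx R)
    *m invmx (map_mx (@tofrac {poly C}) (char_poly_mx (ulsubmx R)))
    *m cst _ _ (ursubmx R)
  + cst _ _ (drsubmx R).

Definition minimal_realization n m (R : 'M[C]_(n + m)) : Prop :=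
  forall n' (R' : 'M[C]_(n' + m)), transfer R' = transfer R -> (n <= n')%N.

(* F must be regular on the whole open right half plane. *)
Definition HP m (T : 'M[C]_m) (F : 'M[{fraction {poly C}}]_m) : Prop :=
  forall s : C, 0 < 'Re s ->
    exists2 V, mx_has_value F s V &
      loewner_ge (V + V^t* ) (T + V^t* *m T *m V).

(* F may have poles on the imaginary axis when T is singular: for 0 < d < 1
   take T = diag(2 d / (1 + d ^ 2), 0) and F(s) = diag(d, 1 / s).  The identity
   is required wherever F(s) is defined. *)
Definition canonical_HP m (T : 'M[C]_m) (F : 'M[{fraction {poly C}}]_m)
  : Prop :=
  HP T F /\
  forall (s : C) (V : 'M[C]_m), 'Re s = 0 -> mx_has_value F s V ->
    V + V^t* - (T + V^t* *m T *m V) = 0.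

Definition KYP_eq n m (T : 'M[C]_m) (H : 'M[C]_n) (R : 'M[C]_(n + m)) : Prop :=
  let J := block_mx (- H) 0 0 1%:M in
  let K : 'M[C]_(m + m, n + m) :=
    block_mx (dlsubmx R) (drsubmx R) 0 1%:M in
  J *m R + R^t* *m J = K^t* *m block_mx T 0 0 T *m K.

End RationalFunctions.

(* Main.v *)
(* With X(s) = (sI - A)^-1 B, the equation (KYP) gives
   F + F^* - T - F^* T F = 2 Re(s) X^* H X, which is the first implication (points
   of the axis where A has an eigenvalue but F is regular are reached by an
   identity of rational functions).  For the inverse array, (C D) R^-1 = (0 I), so
   R^-1 satisfies the same equation with the same H.

   For the converse, the identity on the axis says that a cascade of the system
   with its adjoint has zero response.  By controllability its reachable space is
   the graph of a matrix S, which then solves (KYP); S is Hermitian by uniqueness and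
   nonsingular by observability.  The output feedback u = - y turns A into
   A' = A - B (I + D)^-1 C, for which S A' + A'^* S <= 0; the HP property and
   minimality show that A' is Hurwitz, and Lyapunov's theorem gives S > 0. *)
Require Import Defs.
From HB Require Import structures.
From mathcomp Require Import all_boot all_order all_algebra.
From mathcomp Require Import complex reals.
From mathcomp Require Import ring.

Set Implicit Arguments.
Unset Strict Implicit.
Unset Printing Implicit Defensive.

Import Order.TTheory GRing.Theory Num.Theory.
Local Open Scope ring_scope.
Local Open Scope sesquilinear_scope.

(** * Rules for the conjugate transpose *)

Section ConjugateTranspose.
Variable C : numClosedFieldType.

Lemma ctrD p q (M N : 'M[C]_(p, q)) : (M + N)^t* = M^t* + N^t*.
Proof. by rewrite linearD map_mxD. Qed.

Lemma ctrN p q (M : 'M[C]_(p, q)) : (- M)^t* = - M^t*.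
Proof. by rewrite linearN map_mxN. Qed.

Lemma ctrM p q r (M : 'M[C]_(p, q)) (N : 'M[C]_(q, r)) :
  (M *m N)^t* = N^t* *m M^t*.
Proof. by rewrite trmx_mul map_mxM. Qed.

Lemma ctrZ p q a (M : 'M[C]_(p, q)) : (a *: M)^t* = a^* *: M^t*.
Proof. by rewrite linearZ map_mxZ. Qed.

Lemma ctr0 p q : (0 : 'M[C]_(p, q))^t* = 0.
Proof. by rewrite trmx0 map_mx0. Qed.

Lemma ctr1 n : (1%:M : 'M[C]_n)^t* = 1%:M.
Proof. by rewrite trmx1 map_mx1. Qed.

Lemma ctr_scalar n a : (a%:M : 'M[C]_n)^t* = (a^*)%:M.
Proof. by rewrite tr_scalar_mx map_scalar_mx. Qed.

Lemma ctr_eq0 p q (M : 'M[C]_(p, q)) : (M^t* == 0) = (M == 0).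
Proof. by rewrite map_mx_eq0 trmx_eq0. Qed.

Lemma ctr_unitmx n (M : 'M[C]_n) : (M^t* \in unitmx) = (M \in unitmx).
Proof. by rewrite map_unitmx unitmx_tr. Qed.

Lemma hermsymmxP n (M : 'M[C]_n) : reflect (M^t* = M) (M \is hermsymmx).
Proof.
by rewrite is_hermitianmxE expr0 scale1r eq_sym; apply: eqP.
Qed.

End ConjugateTranspose.

Definition ctrE := (ctrD, ctrN, ctrM, ctrZ, ctr0, ctr1, ctr_scalar, @trmxCK).

(* Products are generalized to atoms, so that [ring] can decide entrywise an
   identity between sums of matrix monomials in left-associated form. *)
Ltac mx_abel :=
  rewrite ?(mulmxDl, mulmxDr, mulNmx, mulmxN, mulmxA, mulmx1, mul1mx, mul0mx, mulmx0);
  repeat match goal with |- context [mulmx ?A ?B] => move: (mulmx A B) => ? end;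
  apply/matrixP => ? ?; rewrite !mxE; ring.

(** * Values of rational functions and rational matrices at a point *)

Section HasValue.
Variable C : numClosedFieldType.
Local Notation K := {fraction {poly C}}.
Implicit Types (f g : K) (s v w : C).

Lemma fraction_repr f :
  exists p q : {poly C}, q != 0 /\ f = tofrac p / tofrac q.
Proof.
elim/quotW: f => x; exists (frac x).1, (frac x).2; split; first exact: denom_ratioP.
have dx : tofrac (frac x).2 != 0 :> K by rewrite tofrac_eq0 denom_ratioP.
apply: (canRL (mulfK dx)); unlock tofrac.
rewrite -[LHS]FracField.pi_mul; apply/eqmodP.
rewrite /= FracField.equivfE /FracField.mulf !numden_Ratio ?mulr1 ?oner_neq0 ?denom_ratioP //.
by rewrite mulrC.
Qed.

Lemma has_value_horner p s : has_value (tofrac p) s p.[s].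
Proof.
by exists p, 1; rewrite hornerC oner_neq0 rmorph1 !divr1.
Qed.

Lemma has_value_cst c s : has_value (tofrac c%:P) s c.
Proof. by rewrite -{2}(hornerC c s); apply: has_value_horner. Qed.

Lemma tofrac_neq0 p s : p.[s] != 0 -> tofrac p != 0 :> K.
Proof. by apply: contraNneq => /eqP; rewrite tofrac_eq0 => /eqP ->; rewrite horner0. Qed.

Lemma has_valueD f g s v w :
  has_value f s v -> has_value g s w -> has_value (f + g) s (v + w).
Proof.
move=> [p [q [qs -> ->]]] [p' [q' [qs' -> ->]]].
exists (p * q' + p' * q), (q * q').
split; first by rewrite hornerM mulf_neq0.
  rewrite tofracD (tofracM p q') (tofracM p' q) (tofracM q q').
  by apply: addf_div; [apply: tofrac_neq0 qs | apply: tofrac_neq0 qs'].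
by rewrite hornerD !hornerM addf_div.
Qed.

Lemma has_valueM f g s v w :
  has_value f s v -> has_value g s w -> has_value (f * g) s (v * w).
Proof.
move=> [p [q [qs -> ->]]] [p' [q' [qs' -> ->]]].
exists (p * p'), (q * q').
split; first by rewrite hornerM mulf_neq0.
  by rewrite (tofracM p p') (tofracM q q') -mulf_div.
by rewrite !hornerM mulf_div.
Qed.

Lemma has_valueN f s v : has_value f s v -> has_value (- f) s (- v).
Proof.
by move=> [p [q [qs -> ->]]]; exists (- p), q; rewrite hornerN tofracN !mulNr.
Qed.

Lemma has_valueV f s v : v != 0 -> has_value f s v -> has_value f^-1 s v^-1.
Proof.
move=> v0 [p [q [qs fE vE]]]; exists q, p.
rewrite fE vE !invf_div; split=> //.
by apply: contraNneq v0 => p0; rewrite vE p0 mul0r.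
Qed.

Lemma has_value_sum (I : finType) (f : I -> K) s (v : I -> C) :
  (forall i, has_value (f i) s (v i)) ->
  has_value (\sum_i f i) s (\sum_i v i).
Proof.
move=> fv; elim/big_rec2: _ => [|i x y _]; last exact: has_valueD.
by rewrite -(rmorph0 (@tofrac {poly C})) -polyC0; apply: has_value_cst.
Qed.

Lemma has_value_prod (I : finType) (f : I -> K) s (v : I -> C) :
  (forall i, has_value (f i) s (v i)) ->
  has_value (\prod_i f i) s (\prod_i v i).
Proof.
move=> fv; elim/big_rec2: _ => [|i x y _]; last exact: has_valueM.
by rewrite -(rmorph1 (@tofrac {poly C})) -polyC1; apply: has_value_cst.
Qed.

Lemma has_value_sign n s : has_value ((-1) ^+ n) s ((-1) ^+ n).
Proof.
rewrite -signr_odd -[X in has_value _ _ X]signr_odd.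
have := has_value_cst 1 s; rewrite polyC1 rmorph1 => h1.
by case: (odd n); rewrite ?expr1 ?expr0 //; apply: has_valueN.
Qed.

(** Rectangular form of [mx_has_value], convertible to it on square matrices. *)
Definition mxval p q (F : 'M[K]_(p, q)) s (V : 'M[C]_(p, q)) :=
  forall i j, has_value (F i j) s (V i j).

Lemma mxval_uniq p q (F : 'M[K]_(p, q)) s V W :
  mxval F s V -> mxval F s W -> V = W.
Proof. by move=> h k; apply/matrixP => i j; apply: has_value_uniq (h i j) (k i j). Qed.

Lemma mxvalD p q (F G : 'M[K]_(p, q)) s V W :
  mxval F s V -> mxval G s W -> mxval (F + G) s (V + W).
Proof. by move=> h k i j; rewrite !mxE; apply: has_valueD. Qed.

Lemma mxvalN p q (F : 'M[K]_(p, q)) s V : mxval F s V -> mxval (- F) s (- V).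
Proof. by move=> h i j; rewrite !mxE; apply: has_valueN. Qed.

Lemma mxvalM p q r (F : 'M[K]_(p, q)) (G : 'M[K]_(q, r)) s V W :
  mxval F s V -> mxval G s W -> mxval (F *m G) s (V *m W).
Proof.
by move=> h k i j; rewrite !mxE; apply: has_value_sum => l; apply: has_valueM.
Qed.

Lemma has_value_det n (F : 'M[K]_n) s V :
  mxval F s V -> has_value (\det F) s (\det V).
Proof.
move=> h; apply: has_value_sum => t; apply: has_valueM; first exact: has_value_sign.
exact: has_value_prod.
Qed.

(** Evaluation commutes with determinants, hence with the adjugate formula for the inverse; [F] is
    invertible because a zero determinant would have the value 0 at [s]. *)
Lemma mxval_inv n (F : 'M[K]_n) s V :
  V \in unitmx -> mxval F s V -> mxval (invmx F) s (invmx V).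
Proof.
move=> Vu h i j; have hd := has_value_det h.
have dV : \det V != 0 by rewrite -unitfE -unitmxE.
have Fu : F \in unitmx.
  rewrite unitmxE unitfE; apply: contra_neq dV => F0; apply: has_value_uniq hd _.
  by rewrite F0 -(rmorph0 (@tofrac {poly C})) -polyC0; apply: has_value_cst.
rewrite /invmx Fu Vu !mxE; apply: has_valueM; first exact: has_valueV.
apply: has_valueM; first exact: has_value_sign.
by apply: has_value_det => k l; rewrite !mxE.
Qed.

(** A nonzero [p] would have the distinct roots ['i * k] for all [k] below its size, one more than
    its degree. *)
Lemma axis_poly_eq0 (p : {poly C}) :
  (forall s, 'Re s = 0 -> p.[s] = 0) -> p = 0.
Proof.
move=> p0; apply/eqP/negPn/negP => pn0.
have := max_poly_roots (rs := [seq 'i * k%:R | k <- iota 0 (size p)]) pn0.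
rewrite size_map size_iota ltnn => /(_ _ _)/notF; apply.
  apply/allP => _ /mapP[k _ ->]; apply/rootP/p0.
  by rewrite ReMr ?realn // Re_i mul0r.
rewrite map_inj_uniq ?iota_uniq // => k l /(mulfI (neq0Ci _)) /eqP.
by rewrite eqr_nat => /eqP.
Qed.

(** For [f = p / q] the polynomial [p * (d * q)] vanishes on the whole axis, at the excluded points
    thanks to the factors [d] and [q]. *)
Lemma axis_fraction_eq0 f (d : {poly C}) : d != 0 ->
  (forall s, 'Re s = 0 -> d.[s] != 0 -> has_value f s 0) -> f = 0.
Proof.
move=> d0 f0; have [p [q [q0 fE]]] := fraction_repr f.
suff /eqP : p * (d * q) = 0.
  by rewrite mulf_eq0 (negPf (mulf_neq0 d0 q0)) orbF fE => /eqP ->; rewrite rmorph0 mul0r.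
apply: axis_poly_eq0 => s s0; rewrite !hornerM.
have [->|ds] := eqVneq d.[s] 0; first by rewrite !(mul0r, mulr0).
have [->|qs] := eqVneq q.[s] 0; first by rewrite !(mul0r, mulr0).
have /eqP : p.[s] / q.[s] = 0 by apply: has_value_uniq (f0 s s0 ds); exists p, q.
by rewrite mulf_eq0 invr_eq0 (negPf qs) orbF => /eqP ->; rewrite mul0r.
Qed.

Lemma axis_matrix_eq0 p q (F : 'M[K]_(p, q)) (d : {poly C}) : d != 0 ->
  (forall s, 'Re s = 0 -> d.[s] != 0 -> mxval F s 0) -> F = 0.
Proof.
move=> d0 F0; apply/matrixP => i j; rewrite mxE.
by apply: (axis_fraction_eq0 d0) => s s0 ds; have := F0 s s0 ds i j; rewrite mxE.
Qed.

End HasValue.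

(** * Resolvents over the field of rational functions and strict properness *)

Section Resolvent.
Variable C : numClosedFieldType.
Local Notation K := {fraction {poly C}}.

(** Convertible to the embedding of constants inside [transfer], but written as a composite of ring
    morphisms so that the rules for [map_mx] apply. *)
Definition cstm p q (M : 'M[C]_(p, q)) : 'M[K]_(p, q) :=
  map_mx (@tofrac {poly C} \o polyC) M.

Definition charK n (A : 'M[C]_n) : 'M[K]_n :=
  map_mx (@tofrac {poly C}) (char_poly_mx A).

Definition resolvent n (A : 'M[C]_n) : 'M[K]_n := invmx (charK A).

Definition sK : K := tofrac 'X.

Lemma cstmD p q (M N : 'M[C]_(p, q)) : cstm (M + N) = cstm M + cstm N.
Proof. exact: map_mxD. Qed.

Lemma cstmN p q (M : 'M[C]_(p, q)) : cstm (- M) = - cstm M.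
Proof. exact: map_mxN. Qed.

Lemma cstmM p q r (M : 'M[C]_(p, q)) (N : 'M[C]_(q, r)) :
  cstm (M *m N) = cstm M *m cstm N.
Proof. exact: map_mxM. Qed.

Lemma cstm0 p q : cstm (0 : 'M[C]_(p, q)) = 0.
Proof. exact: map_mx0. Qed.

Lemma cstm_scalar n c : cstm (c%:M : 'M[C]_n) = (tofrac c%:P)%:M.
Proof. exact: map_scalar_mx. Qed.

Lemma cstm_tr p q (M : 'M[C]_(p, q)) : cstm M^T = (cstm M)^T.
Proof. exact: esym (map_trmx _ _). Qed.

Lemma map_tofrac_inj p q :
  injective (map_mx (@tofrac {poly C}) : 'M_(p, q) -> 'M_(p, q)).
Proof.
move=> M N /matrixP MN; apply/matrixP => i j.
by have := MN i j; rewrite !mxE => /eqP; rewrite tofrac_eq => /eqP.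
Qed.

Lemma mxval_cst p q (M : 'M[C]_(p, q)) s : mxval (cstm M) s M.
Proof. by move=> i j; rewrite mxE; apply: has_value_cst. Qed.

Lemma charKE n (A : 'M[C]_n) : charK A = sK%:M - cstm A.
Proof.
rewrite /charK /char_poly_mx map_mxB; congr (_ - _); first exact: map_scalar_mx.
exact: esym (map_mx_comp _ _ _).
Qed.

Lemma charK_tr n (A : 'M[C]_n) : charK A^T = (charK A)^T.
Proof. by rewrite !charKE linearB /= tr_scalar_mx cstm_tr. Qed.

Lemma det_charK n (A : 'M[C]_n) : \det (charK A) = tofrac (char_poly A).
Proof. exact: det_map_mx. Qed.

Lemma char_poly_neq0 n (A : 'M[C]_n) : char_poly A != 0.
Proof. exact/monic_neq0/char_poly_monic. Qed.

Lemma charK_unit n (A : 'M[C]_n) : charK A \in unitmx.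
Proof. by rewrite unitmxE unitfE det_charK tofrac_eq0 char_poly_neq0. Qed.

Lemma resolvent_tr n (A : 'M[C]_n) : resolvent A^T = (resolvent A)^T.
Proof. by rewrite /resolvent charK_tr trmx_inv. Qed.

Lemma resolvent_mul_sK n (A : 'M[C]_n) : sK *: resolvent A = 1%:M + resolvent A *m cstm A.
Proof.
have := mulVmx (charK_unit A); rewrite {2}charKE mulmxBr mul_mx_scalar.
by move/(canRL (subrK _)).
Qed.

Lemma mxval_char n (A : 'M[C]_n) s : mxval (charK A) s (s%:M - A).
Proof.
move=> i j; rewrite !mxE.
have -> : s *+ (i == j) - A i j = ('X *+ (i == j) - (A i j)%:P).[s].
  by rewrite hornerD hornerN hornerMn hornerX hornerC.
exact: has_value_horner.
Qed.

Lemma unitmx_char_poly n (A : 'M[C]_n) s :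
  (s%:M - A \in unitmx) = ((char_poly A).[s] != 0).
Proof.
rewrite unitmxE unitfE; congr (_ != 0).
apply: has_value_uniq (has_value_det (mxval_char A s)) _.
by rewrite det_charK; apply: has_value_horner.
Qed.

Lemma mxval_resolvent n (A : 'M[C]_n) s :
  s%:M - A \in unitmx -> mxval (resolvent A) s (invmx (s%:M - A)).
Proof. by move=> u; apply: mxval_inv => //; apply: mxval_char. Qed.

Definition tf n p q (A : 'M[C]_n) (B : 'M[C]_(n, q)) (Cm : 'M[C]_(p, n))
  (D : 'M[C]_(p, q)) : 'M[K]_(p, q) := cstm Cm *m resolvent A *m cstm B + cstm D.

Lemma transferE n m (A : 'M[C]_n) B Cm (D : 'M[C]_m) :
  transfer (block_mx A B Cm D) = tf A B Cm D.
Proof. by rewrite /transfer block_mxKul block_mxKur block_mxKdl block_mxKdr. Qed.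

Lemma mxval_tf n p q (A : 'M[C]_n) (B : 'M[C]_(n, q)) (Cm : 'M[C]_(p, n)) D s :
  s%:M - A \in unitmx ->
  mxval (tf A B Cm D) s (Cm *m invmx (s%:M - A) *m B + D).
Proof.
move=> u; apply: mxvalD (mxval_cst _ _); apply: mxvalM (mxval_cst _ _).
by apply: mxvalM (mxval_cst _ _) (mxval_resolvent u).
Qed.

(** In ['X *: N = (char_poly A)%:M + A *m N] take an entry of [N] of largest size. If that size
    exceeded [n], the left side would have a size that neither summand on the right reaches. *)
Lemma size_adj_char_poly_mx n (A : 'M[C]_n) i j :
  (size ((\adj (char_poly_mx A)) i j) <= n)%N.
Proof.
set N := \adj _.
have NE : 'X *: N = (char_poly A)%:M + map_mx polyC A *m N.
  have := mul_mx_adj (char_poly_mx A); rewrite -/N -/(char_poly A).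
  by rewrite {1}/char_poly_mx mulmxBl mul_scalar_mx => /(canRL (subrK _)).
pose sz (ij : 'I_n * 'I_n) := size (N ij.1 ij.2).
have [[k l] _ maxkl] := @arg_maxnP _ (i, j) xpredT sz isT.
apply: leq_trans (maxkl (i, j) isT) _; rewrite leqNgt; apply/negP => big.
have N0 : N k l != 0 by rewrite -size_poly_gt0; apply: leq_ltn_trans big.
have : size ('X * N k l) = (sz (k, l)).+1 by rewrite mulrC size_mulX.
move/matrixP: NE => /(_ k l); rewrite mxE => ->; rewrite mxE => szE.
suff : ((sz (k, l)).+1 <= sz (k, l))%N by rewrite ltnn.
rewrite -szE; apply: leq_trans (size_polyD _ _) _; rewrite geq_max; apply/andP; split.
  rewrite mxE; case: (k == l); last by rewrite size_poly0.
  by rewrite size_char_poly.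
rewrite mxE; apply: leq_trans (size_sum _ _ _) _; apply/bigmax_leqP => r _.
rewrite [map_mx _ _ _ _]mxE mul_polyC; apply: leq_trans (size_scale_leq _ _) _.
exact: (maxkl (r, l) isT).
Qed.

(** After multiplication by [char_poly A], a nonzero entry of [P] would have size above [n], whereas
    the adjugate keeps the other side within [n]. *)
Lemma resolvent_strictly_proper n p q (A : 'M[C]_n) (B : 'M[C]_(n, q))
    (Cm : 'M[C]_(p, n)) (P : 'M[{poly C}]_(p, q)) :
  cstm Cm *m resolvent A *m cstm B = map_mx (@tofrac {poly C}) P -> P = 0.
Proof.
move=> CBP; set N := \adj (char_poly_mx A).
have chi0 : tofrac (char_poly A) != 0 :> K by rewrite tofrac_eq0 char_poly_neq0.
have rsvE : tofrac (char_poly A) *: resolvent A = map_mx (@tofrac {poly C}) N.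
  rewrite /resolvent /invmx charK_unit det_charK scalerA mulfV // scale1r.
  exact: esym (map_mx_adj _ _).
have PE : char_poly A *: P = map_mx polyC Cm *m N *m map_mx polyC B.
  apply: map_tofrac_inj.
  rewrite map_mxZ -CBP !map_mxM -!map_mx_comp -/(cstm Cm) -/(cstm B) -rsvE.
  by rewrite -scalemxAr -scalemxAl.
apply/matrixP => i j; rewrite mxE; apply/eqP/negPn/negP => Pij0.
have : size (char_poly A * P i j) = (n + size (P i j))%N.
  by rewrite size_mul ?char_poly_neq0 // size_char_poly.
move/matrixP: PE => /(_ i j); rewrite mxE => -> szE.
have : (n < size ((map_mx polyC Cm *m N *m map_mx polyC B) i j)%R)%N.
  by rewrite szE -addn1 leq_add2l size_poly_gt0.
apply/negP; rewrite -leqNgt mxE.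
apply: leq_trans (size_sum _ _ _) _; apply/bigmax_leqP => k _.
rewrite [map_mx _ B _ _]mxE mulrC mul_polyC; apply: leq_trans (size_scale_leq _ _) _.
rewrite mxE; apply: leq_trans (size_sum _ _ _) _; apply/bigmax_leqP => l _.
rewrite [map_mx _ _ _ _]mxE mul_polyC; apply: leq_trans (size_scale_leq _ _) _.
exact: size_adj_char_poly_mx.
Qed.

Lemma resolvent_strictly_proper_cst n p q (A : 'M[C]_n) (B : 'M[C]_(n, q))
    (Cm : 'M[C]_(p, n)) (P : 'M[C]_(p, q)) :
  cstm Cm *m resolvent A *m cstm B = cstm P -> P = 0.
Proof.
rewrite /cstm (map_mx_comp _ _ P) => /resolvent_strictly_proper P0.
by apply/matrixP => i j; move/matrixP: P0 => /(_ i j); rewrite !mxE => /polyC_inj.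
Qed.

Lemma resolvent_mulA n p q (A : 'M[C]_n) (B : 'M[C]_(n, q)) (Cm : 'M[C]_(p, n)) :
  cstm Cm *m resolvent A *m cstm (A *m B) =
    sK *: (cstm Cm *m resolvent A *m cstm B) - cstm (Cm *m B).
Proof.
have := congr1 (fun M => cstm Cm *m M *m cstm B) (resolvent_mul_sK A).
rewrite -scalemxAr -scalemxAl => ->.
by rewrite mulmxDr mulmx1 mulmxDl !cstmM !mulmxA [X in X - _]addrC addrK.
Qed.

(** By [resolvent_mulA] the response of [A *m B] is the constant [- Cm *m B], which strict
    properness makes zero. Thus [A *m B] satisfies the hypothesis again, and induction reaches every
    Markov parameter. *)
Lemma resolvent_markov n p q (A : 'M[C]_n) (B : 'M[C]_(n, q)) (Cm : 'M[C]_(p, n)) k :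
  cstm Cm *m resolvent A *m cstm B = 0 -> Cm *m iter k (mulmx A) B = 0.
Proof.
elim: k B => [|k IH] B CB0; have := resolvent_mulA A B Cm;
  rewrite CB0 scaler0 sub0r -cstmN => CAB; have /eqP := resolvent_strictly_proper_cst CAB;
  rewrite oppr_eq0 => /eqP // CB.
by rewrite iterSr; apply: IH; rewrite CAB CB oppr0 cstm0.
Qed.

End Resolvent.

(** * Positive semidefinite forms *)

Section Forms.
Variable C : numClosedFieldType.

Lemma pdmx_psdmx n (M : 'M[C]_n) : pdmx M -> psdmx M.
Proof.
move=> [Mh M0]; split=> // x; have [->|/M0/ltW //] := eqVneq x 0.
by rewrite mulmx0 mxE.
Qed.

Lemma psdmx_ctr_congr p q (M : 'M[C]_p) (X : 'M[C]_(p, q)) :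
  psdmx M -> psdmx (X^t* *m M *m X).
Proof.
move=> [/hermsymmxP Mh M0]; split; first by apply/hermsymmxP; rewrite !ctrE Mh mulmxA.
by move=> x; have := M0 (X *m x); rewrite !ctrE !mulmxA.
Qed.

Lemma psdmxD n (M N : 'M[C]_n) : psdmx M -> psdmx N -> psdmx (M + N).
Proof.
move=> [/hermsymmxP Mh M0] [/hermsymmxP Nh N0]; split.
  by apply/hermsymmxP; rewrite ctrD Mh Nh.
by move=> x; rewrite mulmxDr mulmxDl mxE addr_ge0.
Qed.

Lemma psdmxZ n a (M : 'M[C]_n) : 0 <= a -> psdmx M -> psdmx (a *: M).
Proof.
move=> a0 [/hermsymmxP Mh M0]; split.
  by apply/hermsymmxP; rewrite ctrZ Mh geC0_conj.
by move=> x; rewrite -scalemxAr -scalemxAl mxE mulr_ge0.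
Qed.

Lemma psdmx1 n : psdmx (1%:M : 'M[C]_n).
Proof.
split; first by apply/hermsymmxP; rewrite ctr1.
move=> x; rewrite mulmx1 mxE; apply: sumr_ge0 => i _.
by rewrite !mxE mulrC mul_conjC_ge0.
Qed.

Lemma addCJ (s : C) : s + s^* = 'Re s *+ 2.
Proof. by rewrite ReE -mulr_natr divfK ?pnatr_eq0. Qed.

Lemma non_unitmx_ker (F : fieldType) n (M : 'M[F]_n) :
  M \notin unitmx -> exists2 x : 'cV[F]_n, x != 0 & M *m x = 0.
Proof.
rewrite -unitmx_tr unitmxE unitfE negbK => /det0P[v v0 vM].
exists v^T; first by rewrite trmx_eq0.
by apply: trmx_inj; rewrite trmx_mul trmxK vM trmx0.
Qed.

End Forms.

(** * The matrix equation by blocks and the energy balance *)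

Section KYP.
Variables (C : numClosedFieldType) (n m : nat).
Variables (A : 'M[C]_n) (B : 'M[C]_(n, m)) (Cm : 'M[C]_(m, n)) (D T : 'M[C]_m).
Variable H : 'M[C]_n.

(** The upper left, upper right and lower right blocks of [KYP_eq]; for Hermitian [H] and [T] the
    lower left block is the adjoint of the upper right one. *)
Definition kyp := [/\ H *m A + A^t* *m H = - (Cm^t* *m T *m Cm),
  H *m B = Cm^t* - Cm^t* *m T *m D & D + D^t* = T + D^t* *m T *m D].

Lemma KYP_eqP : H^t* = H -> T^t* = T -> KYP_eq T H (block_mx A B Cm D) <-> kyp.
Proof.
move=> Hh Th; rewrite /KYP_eq /kyp block_mxKdl block_mxKdr.
rewrite !tr_block_mx !map_block_mx !mulmx_block !add_block_mx.
rewrite !(trmx0, trmx1, map_mx0, map_mx1) !(mul0mx, mulmx0, mul1mx, mulmx1, addr0, add0r).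
rewrite !mulNmx !mulmxN; split.
- move=> /eq_block_mx[ul ur _ dr]; split.
  + by rewrite -ul opprD !opprK.
  + by rewrite -ur opprD opprK addrCA subrr addr0.
  + by rewrite dr addrC.
- move=> [e1 e2 e3]; congr block_mx.
  + by rewrite -opprD e1 opprK.
  + by rewrite e2 opprB subrK.
  + have := congr1 (fun M => M^t*) e2; rewrite !ctrE Hh Th => ->.
    by rewrite opprB addrC subrK !mulmxA.
  + by rewrite e3 addrC.
Qed.

(** Pairing [s X = A X + B] with [H X] and adding the adjoint relation gives an expression in which
    [kyp] eliminates [H]. *)
Lemma kyp_identity s X : H^t* = H -> T^t* = T -> kyp -> (s%:M - A) *m X = B ->
  let V := Cm *m X + D in
  V + V^t* - (T + V^t* *m T *m V) = (s + s^*) *: (X^t* *m H *m X).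
Proof.
move=> Hh Th [e1 e2 e3] XB V.
have sX : s *: X = A *m X + B by rewrite -XB mulmxBl mul_scalar_mx addrC subrK.
have sXc : s^* *: X^t* = X^t* *m A^t* + B^t*.
  by have := congr1 (fun M => M^t*) sX; rewrite !ctrE.
have BH : B^t* *m H = Cm - D^t* *m T *m Cm.
  by have := congr1 (fun M => M^t*) e2; rewrite !ctrE Hh Th mulmxA.
have -> : (s + s^*) *: (X^t* *m H *m X)
    = X^t* *m (H *m A + A^t* *m H) *m X + X^t* *m (H *m B) + B^t* *m H *m X.
  rewrite scalerDl scalemxAr sX 2!scalemxAl sXc; mx_abel.
rewrite e1 e2 BH /V.
(* Only the constant [T] is expanded by the third equation, not the one inside the quadratic term; a
   formal identity remains. *)
rewrite [X in _ - (X + _)](_ : T = D + D^t* - D^t* *m T *m D); last by rewrite e3 addrK.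
rewrite !ctrE; mx_abel.
Qed.

End KYP.

(** * Conjugation on the imaginary axis as an operation on rational functions *)

Section Axis.
Variable C : numClosedFieldType.
Local Notation K := {fraction {poly C}}.

(** The coefficients are conjugated and [s] is replaced by [- s], which is the conjugate of [s] on
    the axis. *)
Definition reflp (p : {poly C}) : {poly C} := map_poly Num.conj p \Po - 'X.

Lemma horner_reflp p (s : C) : 'Re s = 0 -> (reflp p).[s] = p.[s]^*.
Proof.
move=> s0; rewrite horner_comp hornerN hornerX.
have -> : - s = s^*.
  by apply/eqP; rewrite eq_sym -addr_eq0 addrC addCJ s0 mul0rn.
exact: horner_map.
Qed.

Lemma reflpM p q : reflp (p * q) = reflp p * reflp q.
Proof. by rewrite /reflp rmorphM comp_polyM. Qed.

Lemma reflp_eq0 p : (reflp p == 0) = (p == 0).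
Proof.
apply/eqP/eqP => [p0|->]; last by rewrite /reflp map_poly0 comp_poly0.
apply: axis_poly_eq0 => s s0; apply/eqP; rewrite -conjC_eq0 -horner_reflp //.
by rewrite p0 horner0.
Qed.

Lemma reflected_fraction (f : K) : exists g : K, forall s v,
  'Re s = 0 -> has_value f s v -> has_value g s v^*.
Proof.
have [p [q [q0 fE]]] := fraction_repr f.
exists (tofrac (reflp p) / tofrac (reflp q)) => s v s0 [p' [q' [qs' fE' ->]]].
exists (reflp p'), (reflp q'); split.
- by rewrite horner_reflp // conjC_eq0.
(* The fraction regular at [s] may differ from the fixed [p / q]; reflecting the cross products
   shows that both define the same [g]. *)
- have q'0 : q' != 0 by apply: contraNneq qs' => ->; rewrite horner0.
  have /eqP := etrans (esym fE) fE'.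
  rewrite eqr_div ?tofrac_eq0 // -!tofracM tofrac_eq => /eqP pq.
  by apply/eqP; rewrite eqr_div ?tofrac_eq0 ?reflp_eq0 // -!tofracM -!reflpM pq.
- by rewrite !horner_reflp // fmorph_div.
Qed.

(** [G] is the para-Hermitian conjugate of [F], which turns an identity involving adjoints on the
    axis into one between rational matrices. *)
Lemma reflected_matrix p q (F : 'M[K]_(p, q)) : exists G : 'M[K]_(q, p),
  forall s V, 'Re s = 0 -> mxval F s V -> mxval G s (V^t*).
Proof.
have /fin_all_exists[g gP] : forall ij : 'I_p * 'I_q, exists g : K, forall s v,
    'Re s = 0 -> has_value (F ij.1 ij.2) s v -> has_value g s v^*.
  by move=> ij; apply: reflected_fraction.
exists (\matrix_(i, j) g (j, i)) => s V s0 FV i j.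
by rewrite !mxE; apply: gP.
Qed.

(** The defect [E] is a rational matrix vanishing on the axis away from the roots of [d], hence
    zero; it can then be evaluated wherever [F] is regular on the axis. *)
Lemma axis_identity m (T : 'M[C]_m) (F : 'M[K]_m) (d : {poly C}) : d != 0 ->
  (forall s, 'Re s = 0 -> d.[s] != 0 ->
    exists2 V, mxval F s V & V + V^t* - (T + V^t* *m T *m V) = 0) ->
  forall s V, 'Re s = 0 -> mxval F s V -> V + V^t* - (T + V^t* *m T *m V) = 0.
Proof.
move=> d0 Fd s V s0 FV; have [G GP] := reflected_matrix F.
pose E := F + G - (cstm T + G *m cstm T *m F).
have EP t W : 'Re t = 0 -> mxval F t W ->
    mxval E t (W + W^t* - (T + W^t* *m T *m W)).
  move=> t0 FW; have GW := GP t W t0 FW.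
  apply: mxvalD (mxvalD FW GW) (mxvalN (mxvalD (mxval_cst _ _) _)).
  exact: mxvalM (mxvalM GW (mxval_cst _ _)) FW.
suff E0 : E = 0.
  by apply: (mxval_uniq (EP _ _ s0 FV)); rewrite E0 -cstm0; apply: mxval_cst.
apply: (axis_matrix_eq0 d0) => t t0 dt.
by have [W FW <-] := Fd t t0 dt; apply: EP.
Qed.

End Axis.

(** * Sufficiency of the matrix equation, and its invariance under inversion of the array *)

Section Forward.
Variables (C : numClosedFieldType) (n m : nat).
Variables (A : 'M[C]_n) (B : 'M[C]_(n, m)) (Cm : 'M[C]_(m, n)) (D T : 'M[C]_m).

(** An eigenvector [x] for such an [s] would make [2 Re(s)] times the positive form of [H] at [x]
    equal to minus the form of [T] at [Cm *m x]. *)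
Lemma kyp_no_right_eigenvalue (H : 'M[C]_n) s : pdmx H -> psdmx T ->
  kyp A B Cm D T H -> 0 < 'Re s -> s%:M - A \in unitmx.
Proof.
move=> [/hermsymmxP Hh Hpos] [_ T0] [e1 _ _] s0; apply/negPn/negP => /non_unitmx_ker[x x0].
rewrite mulmxBl mul_scalar_mx => /eqP; rewrite subr_eq0 => /eqP sx.
have sxc : s^* *: x^t* = x^t* *m A^t* by have := congr1 (fun M => M^t*) sx; rewrite !ctrE.
have : (s + s^*) *: (x^t* *m H *m x) = - ((Cm *m x)^t* *m T *m (Cm *m x)).
  rewrite scalerDl scalemxAr sx 2!scalemxAl sxc.
  have -> : - ((Cm *m x) ^t* *m T *m (Cm *m x)) = x^t* *m (- (Cm^t* *m T *m Cm)) *m x.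
    by rewrite !ctrE; mx_abel.
  by rewrite -e1; mx_abel.
move/matrixP => /(_ 0 0); rewrite [LHS]mxE [RHS]mxE => e.
have := T0 (Cm *m x); rewrite -oppr_le0 -e; apply/negP; rewrite lt_geF //.
by rewrite mulr_gt0 ?Hpos // addCJ mulrn_wgt0.
Qed.

Lemma kyp_canonical (H : 'M[C]_n) : pdmx H -> psdmx T ->
  kyp A B Cm D T H -> canonical_HP T (tf A B Cm D).
Proof.
move=> Hpos T0 eqs; have [/hermsymmxP Hh _] := Hpos; have [/hermsymmxP Th _] := T0.
have val s : s%:M - A \in unitmx -> exists2 V, mxval (tf A B Cm D) s V &
    exists X, V + V^t* - (T + V^t* *m T *m V) = (s + s^*) *: (X^t* *m H *m X).
  move=> u; exists (Cm *m (invmx (s%:M - A) *m B) + D).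
    by rewrite mulmxA; apply: mxval_tf.
  exists (invmx (s%:M - A) *m B).
  exact: (kyp_identity Hh Th eqs (mulKVmx u _)).
split.
  move=> s s0; have [V FV [X VX]] := val s (kyp_no_right_eigenvalue Hpos T0 eqs s0).
  exists V => //; rewrite /loewner_ge VX; apply: psdmxZ.
    by rewrite addCJ mulrn_wge0 // ltW.
  exact/psdmx_ctr_congr/pdmx_psdmx.
(* It suffices to check the points of the axis outside the spectrum of [A]. *)
apply: (@axis_identity _ _ _ _ (char_poly A)); first exact: char_poly_neq0.
move=> s s0 ds; have [|V FV [X VX]] := val s; first by rewrite unitmx_char_poly.
by exists V => //; rewrite VX addCJ s0 mul0rn scale0r.
Qed.

End Forward.

Lemma KYP_canonical (C : numClosedFieldType) n m (T : 'M[C]_m) (H : 'M[C]_n)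
    (R : 'M[C]_(n + m)) : pdmx H -> psdmx T ->
  KYP_eq T H R -> canonical_HP T (transfer R).
Proof.
move=> Hpos T0; rewrite -[R]submxK transferE => /KYP_eqP eqs.
apply: (kyp_canonical Hpos T0); apply: eqs; apply/hermsymmxP.
  by case: Hpos.
by case: T0.
Qed.

(* [(C D) R^-1 = (0 I)], so passing to the inverse only swaps the two block
   rows of the right-hand factor. *)
Lemma KYP_eq_inv (C : numClosedFieldType) n m (T : 'M[C]_m) (H : 'M[C]_n)
    (R : 'M[C]_(n + m)) : R \in unitmx ->
  KYP_eq T H R -> KYP_eq T H (invmx R).
Proof.
move=> Ru; rewrite /KYP_eq.
set J := block_mx (- H) 0 0 1%:M; set S := invmx R.
set K := block_mx (dlsubmx R) _ _ _; set L := block_mx (dlsubmx S) _ _ _ => eq.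
pose P : 'M[C]_(m + m) := block_mx 0 1%:M 1%:M 0.
have rowE (M : 'M[C]_(n + m)) : row_mx (dlsubmx M) (drsubmx M) = row_mx 0 1%:M *m M.
  by rewrite -[in RHS](vsubmxK M) mul_row_col mul0mx mul1mx add0r hsubmxK.
have blockE (M : 'M[C]_(n + m)) : block_mx (dlsubmx M) (drsubmx M) 0 1%:M =
    col_mx (row_mx 0 1%:M *m M) (row_mx 0 1%:M) by rewrite -rowE.
have KSE : K *m S = P *m L.
  rewrite /K /L !blockE mul_col_mx -mulmxA mulmxV // mulmx1.
  by rewrite mul_block_col !mul0mx !mul1mx add0r addr0.
have St : S^t* *m R^t* = 1%:M by rewrite -ctrM mulmxV // ctr1.
have -> : J *m S + S^t* *m J = S^t* *m (J *m R + R^t* *m J) *m S.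
  rewrite mulmxDr mulmxDl !mulmxA St mul1mx -!mulmxA mulmxV // mulmx1.
  by rewrite addrC.
have PTP : P^t* *m block_mx T 0 0 T *m P = block_mx T 0 0 T.
  rewrite /P tr_block_mx map_block_mx !mulmx_block !(trmx0, trmx1, map_mx0, map_mx1).
  by rewrite !(mulmx0, mul0mx, mulmx1, mul1mx, addr0, add0r).
rewrite eq; set TT := block_mx T 0 0 T in PTP *.
have -> : S^t* *m (K^t* *m TT *m K) *m S = (K *m S)^t* *m TT *m (K *m S).
  by rewrite ctrM !mulmxA.
by rewrite KSE ctrM -[in RHS]PTP !mulmxA.
Qed.

(** The rows of [W] are a basis of the left kernel of [u], a hyperplane that does not contain [v].
    The choice of [u] thus decides which complement of the line of [v] is used. *)
Lemma exists_row_complement (F : fieldType) n (v : 'rV[F]_n.+1) (u : 'cV[F]_n.+1) :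
  (v *m u) 0 0 != 0 -> exists W : 'M[F]_(n, n.+1),
    W *m u = 0 /\ (col_mx v W : 'M_(1 + n)) \in unitmx.
Proof.
move=> vu0.
have ru : \rank u = 1%N.
  apply/eqP; rewrite eqn_leq rank_leq_col lt0n mxrank_eq0.
  by apply: contraNneq vu0 => ->; rewrite mulmx0 mxE.
have [W [Wf Wu]] : exists W : 'M[F]_(n, n.+1), row_free W /\ W *m u = 0.
  (* The number of rows is first left as a rank and rewritten to [n] afterwards, which spares a
     cast. *)
  have : exists W : 'M[F]_(\rank (kermx u), n.+1), row_free W /\ W *m u = 0.
    exists (row_base (kermx u)); split; first exact: row_base_free.
    by apply/eqP; rewrite -sub_kermx eq_row_base.
  by rewrite mxrank_ker ru subn1.
exists W; split=> //; rewrite -row_free_unit; apply: inj_row_free => x.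
rewrite -[x]hsubmxK mul_row_col => e.
have x1 : lsubmx x = 0.
  have /matrixP/(_ 0 0) := congr1 (fun M => M *m u) e.
  rewrite mulmxDl -!mulmxA Wu mulmx0 addr0 mul0mx [RHS]mxE mxE big_ord1 => /eqP.
  rewrite mulf_eq0 (negPf vu0) orbF => /eqP x1.
  by apply/matrixP => i j; rewrite !ord1 x1 mxE.
move: e; rewrite x1 mul0mx add0r => /eqP; rewrite (mulmx_free_eq0 _ Wf) => /eqP ->.
by rewrite row_mx0.
Qed.

(** * Controllability and observability of minimal realizations *)

Section Controllability.
Variable C : numClosedFieldType.

(** The relation [A *m P = P *m A1] passes to the characteristic matrices and so to the resolvents.
    With [r < n] it exhibits a smaller realization. *)
Lemma tf_intertwine n r p q (A : 'M[C]_n) (B : 'M[C]_(n, q)) (Cm : 'M[C]_(p, n)) D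
    (A1 : 'M[C]_r) (B1 : 'M[C]_(r, q)) (P : 'M[C]_(n, r)) :
  A *m P = P *m A1 -> B = P *m B1 -> tf A B Cm D = tf A1 B1 (Cm *m P) D.
Proof.
move=> AP ->; rewrite /tf; congr (_ + _); rewrite !cstmM !mulmxA; congr (_ *m _).
rewrite -!mulmxA; congr (_ *m _).
have e : charK A *m cstm P = cstm P *m charK A1.
  by rewrite !charKE mulmxBl mulmxBr -!cstmM AP mul_scalar_mx mul_mx_scalar.
by apply: (canRL (mulmxK (charK_unit A1))); rewrite -mulmxA -e mulKmx ?charK_unit.
Qed.

Lemma transfer_tr n m (R : 'M[C]_(n + m)) : transfer R^T = (transfer R)^T.
Proof.
rewrite -[R]submxK tr_block_mx !transferE /tf linearD /= !trmx_mul !cstm_tr resolvent_tr.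
by rewrite mulmxA.
Qed.

Lemma minimal_realization_tr n m (R : 'M[C]_(n + m)) :
  minimal_realization R -> minimal_realization R^T.
Proof.
move=> Rmin n' R' e; apply: (Rmin n' R'^T).
by rewrite transfer_tr e transfer_tr trmxK.
Qed.

(** If [w] were nonzero, its kernel would be an [A]-invariant hyperplane containing the columns of
    [B], and the restriction to it would realize the same function with one state less. *)
Lemma minimal_left_eigenvector n m (A : 'M[C]_n) B Cm (D : 'M[C]_m) a (w : 'rV_n) :
  minimal_realization (block_mx A B Cm D) ->
  w *m A = a *: w -> w *m B = 0 -> w = 0.
Proof.
case: n => [|n] in A B Cm w * => Rmin wA wB; first by rewrite thinmx0.
apply/eqP/negPn/negP => /rV0Pn[j wj].
have [|W [_ Uu]] := @exists_row_complement _ _ w (delta_mx j 0).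
  by rewrite -colE mxE.
(* The columns of [P] form a basis of the kernel of [w], and [W] gives the coordinates in it. *)
pose P := rsubmx (invmx (col_mx w W : 'M_(1 + n))).
pose L := lsubmx (invmx (col_mx w W : 'M_(1 + n))).
have LP : L *m w + P *m W = 1%:M by rewrite -mul_row_col hsubmxK mulVmx.
have wP : w *m P = 0.
  have := mulmxV Uu; rewrite -[invmx _]hsubmxK (@scalar_mx_block _ 1 n).
  by rewrite mul_col_row => /eq_block_mx[].
have AP : A *m P = P *m (W *m A *m P).
  rewrite -[LHS]mul1mx -LP mulmxDl !mulmxA -[L *m w *m A]mulmxA wA.
  by rewrite -scalemxAr -scalemxAl -[L *m w *m P]mulmxA wP mulmx0 scaler0 add0r.
have BE : B = P *m (W *m B).
  by rewrite -[LHS]mul1mx -LP mulmxDl -!mulmxA wB mulmx0 add0r.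
have := Rmin _ (block_mx (W *m A *m P) (W *m B) (Cm *m P) D).
by rewrite !transferE -(tf_intertwine _ _ AP BE) => /(_ erefl); rewrite ltnn.
Qed.

Lemma minimal_right_eigenvector n m (A : 'M[C]_n) B Cm (D : 'M[C]_m) a (v : 'cV_n) :
  minimal_realization (block_mx A B Cm D) ->
  A *m v = a *: v -> Cm *m v = 0 -> v = 0.
Proof.
move/minimal_realization_tr; rewrite tr_block_mx => Rmin Av Cv.
apply: trmx_inj; rewrite trmx0; apply: (minimal_left_eigenvector (a := a) Rmin).
  by rewrite -trmx_mul Av linearZ.
by rewrite -trmx_mul Cv trmx0.
Qed.

(* With [s] the list of the eigenvalues, the Cayley-Hamilton theorem provides
   the vanishing product; an eigenvector is the last nonzero partial product. *)
Lemma krylov_eigenvector n m (A : 'M[C]_n.+1) (B : 'M[C]_(n.+1, m)) (s : seq C)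
    (w : 'rV_n.+1) : w != 0 ->
  (forall k, (k < size s)%N -> w *m iter k (mulmx A) B = 0) ->
  w *m (\prod_(z <- s) (A - z%:M)) = 0 ->
  exists a, exists2 v : 'rV_n.+1, v != 0 & v *m A = a *: v /\ v *m B = 0.
Proof.
elim: s w => [|z s IH] w w0 wB; first by rewrite big_nil mulmx1 => /eqP; rewrite (negPf w0).
rewrite big_cons -mulmxE mulmxA => wP.
have [wz|wz] := eqVneq (w *m (A - z%:M)) 0.
  exists z, w => //; split; last by apply: (wB 0%N).
  by apply/eqP; rewrite -subr_eq0 -mul_mx_scalar -mulmxBr wz.
apply: (IH _ wz) => // k ks.
rewrite mulmxBr mulmxBl -mulmxA -iterS wB // mul_mx_scalar -scalemxAl wB 1?ltnW //.
by rewrite scaler0 subr0.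
Qed.

(** Full row rank of the Kalman matrix with blocks [A ^ k B], [k < n], expressed by its left
    annihilators. *)
Definition controllable n m (A : 'M[C]_n) (B : 'M[C]_(n, m)) :=
  forall p (W : 'M[C]_(p, n)),
    (forall k, (k < n)%N -> W *m iter k (mulmx A) B = 0) -> W = 0.

(** A nonzero row of [W] is fed to [krylov_eigenvector]; the eigenvalues of [A] with multiplicity
    are exactly as many as the powers that this row annihilates. *)
Lemma hautus n m (A : 'M[C]_n) (B : 'M[C]_(n, m)) :
  (forall a (w : 'rV_n), w *m A = a *: w -> w *m B = 0 -> w = 0) ->
  controllable A B.
Proof.
case: n => [|n] in A B * => AB p W WB; first by rewrite thinmx0.
apply/row_matrixP => i; rewrite row0; apply/eqP/negPn/negP => w0.
have [s /= sE] := closed_field_poly_normal (char_poly A).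
have {}sE : char_poly A = \prod_(z <- s) ('X - z%:P).
  by rewrite {1}sE (monicP (char_poly_monic A)) scale1r.
have szs : size s = n.+1.
  by apply: succn_inj; rewrite -(size_char_poly A) sE size_prod_XsubC.
have [||a [v v0 [vA vB]]] := @krylov_eigenvector _ _ A B s (row i W) w0.
- by move=> k; rewrite szs -row_mul => /WB ->; rewrite row0.
- have -> : \prod_(z <- s) (A - z%:M) = horner_mx A (char_poly A).
    rewrite sE rmorph_prod; apply: eq_bigr => z _.
    by rewrite rmorphB /= horner_mx_X horner_mx_C.
  by rewrite Cayley_Hamilton mulmx0.
by move: v0; rewrite (AB a v vA vB) eqxx.
Qed.

Lemma minimal_controllable n m (A : 'M[C]_n) B Cm (D : 'M[C]_m) :
  minimal_realization (block_mx A B Cm D) -> controllable A B.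
Proof. by move=> Rmin; apply: hautus => a w; apply: minimal_left_eigenvector Rmin. Qed.

Lemma iter_mulmx_tr n m p (A : 'M[C]_n) (M : 'M[C]_(m, n)) (N : 'M[C]_(n, p)) k :
  (M *m iter k (mulmx A) N)^T = N^T *m iter k (mulmx A^T) M^T.
Proof.
elim: k N => [|k IH] N; first exact: trmx_mul.
by rewrite iterSr IH trmx_mul -mulmxA.
Qed.

Lemma minimal_observable n m (A : 'M[C]_n) B Cm (D : 'M[C]_m) p (V : 'M_(n, p)) :
  minimal_realization (block_mx A B Cm D) ->
  (forall k, Cm *m iter k (mulmx A) V = 0) -> V = 0.
Proof.
move/minimal_realization_tr; rewrite tr_block_mx => /minimal_controllable ctA CV.
by apply: trmx_inj; rewrite trmx0; apply: ctA => k _; rewrite -iter_mulmx_tr CV trmx0.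
Qed.

End Controllability.

(** * Semidefinite kernels and Lyapunov's theorem *)

Section Lyapunov.
Variable C : numClosedFieldType.

Lemma dotmx_ge0 n (x : 'rV[C]_n) : 0 <= (x *m x^t*) 0 0.
Proof.
by rewrite mxE; apply: sumr_ge0 => i _; rewrite !mxE mul_conjC_ge0.
Qed.

Lemma dotmx_eq0 n (x : 'rV[C]_n) : (x *m x^t*) 0 0 = 0 -> x = 0.
Proof.
rewrite mxE => /psumr_eq0P x0; apply/rowP => i; rewrite mxE; apply/eqP.
rewrite -mul_conjC_eq0; apply/eqP.
have := x0 _ i isT; rewrite !mxE; apply => j _.
by rewrite !mxE mul_conjC_ge0.
Qed.

(** The form is tested on [x + t *: y] with [y = x *m Q]: for small positive [t] the cross term,
    proportional to the squared norm of [y], would make it positive. *)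
Lemma nsd_form_kernel n (Q : 'M[C]_n) (x : 'rV[C]_n) : Q^t* = Q ->
  (forall y : 'rV_n, (y *m Q *m y^t*) 0 0 <= 0) ->
  (x *m Q *m x^t*) 0 0 = 0 -> x *m Q = 0.
Proof.
move=> Qh Q0 xQx; set y := x *m Q.
set N := (y *m y^t*) 0 0; set c := (y *m Q *m y^t*) 0 0.
have N0 : 0 <= N by apply: dotmx_ge0.
have c0 : c <= 0 by apply: Q0.
have c1 : 0 < 1 - c by rewrite subr_gt0; apply: le_lt_trans c0 ltr01.
(* An explicit small step: the form becomes [N ^+ 2 * (2 - c) / (1 - c) ^+ 2], whose last two
   factors are positive since [c <= 0]. *)
pose t := N / (1 - c).
have t0 : 0 <= t by rewrite divr_ge0 // ltW.
have := Q0 (x + t *: y).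
have -> : ((x + t *: y) *m Q *m (x + t *: y)^t*) 0 0 = t * N *+ 2 + t ^+ 2 * c.
  have yE : y^t* = Q *m x^t* by rewrite /y ctrM Qh.
  have e1 : (x *m Q *m y^t*) 0 0 = N by [].
  have e2 : (y *m Q *m x^t*) 0 0 = N by rewrite -mulmxA -yE.
  rewrite ctrD ctrZ (geC0_conj t0) !(mulmxDl, mulmxDr) -!(scalemxAl, scalemxAr).
  rewrite scalerA.
  transitivity ((x *m Q *m x^t*) 0 0 + t * (y *m Q *m x^t*) 0 0
    + (t * (x *m Q *m y^t*) 0 0 + t * t * c)).
    by rewrite /c; do 4 rewrite ?mxE //.
  by rewrite xQx e1 e2; ring.
have -> : t * N *+ 2 + t ^+ 2 * c = N ^+ 2 * (2 - c) / (1 - c) ^+ 2.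
  by rewrite /t; field; rewrite gt_eqF.
have c2 : 0 < 2 - c by rewrite subr_gt0; apply: le_lt_trans c0 _; rewrite ltr0n.
rewrite pmulr_lle0 ?invr_gt0 ?exprn_gt0 // pmulr_lle0 // => N2.
by apply/dotmx_eq0/eqP; rewrite -/N -sqrf_eq0 eq_le N2 exprn_ge0.
Qed.

Lemma psdmx_kernel p (Q : 'M[C]_p) (x : 'cV[C]_p) :
  psdmx Q -> (x^t* *m Q *m x) 0 0 = 0 -> Q *m x = 0.
Proof.
move=> [/hermsymmxP Qh Q0] xQ; apply/eqP; rewrite -ctr_eq0 ctrM Qh; apply/eqP.
have : x^t* *m (- Q) = 0; last by rewrite mulmxN => /eqP; rewrite oppr_eq0 => /eqP.
apply: nsd_form_kernel; first by rewrite ctrN Qh.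
  move=> y; rewrite mulmxN mulNmx mxE oppr_le0.
  by have := Q0 (y^t*); rewrite trmxCK.
by rewrite mulmxN mulNmx trmxCK mxE xQ oppr0.
Qed.

Lemma unitmx_row_eq0 n (M : 'M[C]_n) p (X : 'M[C]_(p, n)) :
  M \in unitmx -> X *m M = 0 -> X = 0.
Proof. by move=> u XM; rewrite -(mulmxK u X) XM mul0mx. Qed.

(** Induction on the size: a left eigenvector [v] of [A] is split off together with its
    [S]-orthogonal complement. In the new basis [S] is block diagonal and [A] block triangular, so
    the hypotheses pass to the smaller blocks [S2] and [A2]. *)
Lemma lyapunov_pos n (A S : 'M[C]_n) : S^t* = S -> S \in unitmx ->
  (forall x : 'rV_n, (x *m (A *m S + S *m A^t*) *m x^t*) 0 0 <= 0) ->
  (forall a (x : 'rV_n), x != 0 -> x *m A = a *: x -> 'Re a < 0) ->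
  forall x : 'rV_n, x != 0 -> 0 < (x *m S *m x^t*) 0 0.
Proof.
elim: n => [|n IH] in A S * => Sh Su AS Aev x x0; first by move: x0; rewrite thinmx0 eqxx.
have [a /eigenvalueP[v vA v0]] := eigenvalue_closed A (ltn0Sn n).
have aneg := Aev a v v0 vA.
have vAc : A^t* *m v^t* = a^* *: v^t* by have := congr1 (fun M => M^t*) vA; rewrite !ctrE.
have Qh : (A *m S + S *m A^t*)^t* = A *m S + S *m A^t* by rewrite !ctrE Sh addrC.
have vQv : (v *m (A *m S + S *m A^t*) *m v^t*) 0 0 = (a + a^*) * (v *m S *m v^t*) 0 0.
  rewrite mulmxDr mulmxDl !mulmxA vA -(mulmxA (v *m S)) vAc -!scalemxAl -scalemxAr.
  by rewrite -scalerDl mxE.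
have a2 : a + a^* < 0 by rewrite addCJ mulrn_wlt0.
(* An isotropic [v] would lie in the kernel of the Lyapunov form, and then minus the conjugate of
   [a] would be an eigenvalue of [A] with positive real part. *)
have s0 : (v *m S *m v^t*) 0 0 != 0.
  apply/eqP => s0; have vQ : v *m (A *m S + S *m A^t*) = 0.
    by apply: nsd_form_kernel => //; rewrite vQv s0 mulr0.
  have vS0 : v *m S != 0 by apply: contra_neq v0 => /(unitmx_row_eq0 Su).
  have vSA : v *m S *m A^t* = - a *: (v *m S).
    move: vQ; rewrite mulmxDr !mulmxA vA -scalemxAl => /eqP.
    by rewrite addrC addr_eq0 scaleNr => /eqP.
  have AvS : A *m (v *m S)^t* = (- a)^* *: (v *m S)^t*.
    by have := congr1 (fun M => M^t*) vSA; rewrite ctrM trmxCK => ->; rewrite ctrZ.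
  have : \det (A - ((- a)^*)%:M) == 0.
    rewrite -[_ == 0]negbK -unitfE -unitmxE; apply: contra vS0 => u.
    rewrite -ctr_eq0; apply/eqP; rewrite -(mulKmx u (_^t*)) mulmxBl AvS mul_scalar_mx.
    by rewrite subrr mulmx0.
  move/det0P => [z z0]; rewrite mulmxBr mul_mx_scalar => /eqP; rewrite subr_eq0 => /eqP.
  move/(Aev _ _ z0); rewrite Re_conj raddfN oppr_lt0 => apos.
  by have := lt_trans aneg apos; rewrite ltxx.
have spos : 0 < (v *m S *m v^t*) 0 0.
  have Sreal : (v *m S *m v^t*) 0 0 \is Num.real.
    have /matrixP/(_ 0 0) : (v *m S *m v^t*)^t* = v *m S *m v^t* by rewrite !ctrE Sh mulmxA.
    by rewrite [LHS]mxE [X in X^*]mxE => /CrealP.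
  rewrite lt0r s0 /=; have := AS v; rewrite vQv.
  by rewrite nmulr_rle0.
(* With [u = S *m v^t*] the rows of [W] are [S]-orthogonal to [v]. *)
have [W [Wu Uu]] := @exists_row_complement _ _ v (S *m v^t*) ltac:(by rewrite mulmxA).
set U : 'M_(1 + n) := col_mx v W in Uu.
pose L := lsubmx (invmx U); pose P := rsubmx (invmx U).
have LP : L *m v + P *m W = 1%:M by rewrite -mul_row_col hsubmxK mulVmx.
have vSW : v *m S *m W^t* = 0.
  by have := congr1 (fun M => M^t*) Wu; rewrite !ctrE Sh.
rewrite mulmxA in Wu.
have [b [A2 WA]] : exists b A2, W *m A = b *m v + A2 *m W.
  by exists (W *m A *m L), (W *m A *m P); rewrite -[LHS]mulmx1 -LP mulmxDr !mulmxA.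
have [S2 S2E] : exists S2, S2 = W *m S *m W^t* by eexists.
have WAc : A^t* *m W^t* = v^t* *m b^t* + W^t* *m A2^t*.
  by have := congr1 (fun M => M^t*) WA; rewrite !ctrE.
have S2h : S2^t* = S2 by rewrite S2E !ctrE Sh mulmxA.
have S2u : S2 \in unitmx.
  rewrite unitmxE unitfE; apply/det0P => -[y y0 yS2]; case/eqP: y0.
  have yW : y *m W = 0.
    apply: (unitmx_row_eq0 Su); apply: (@unitmx_row_eq0 _ (U^t*)); first by rewrite ctr_unitmx.
    rewrite /U tr_col_mx map_row_mx mul_mx_row -!mulmxA (mulmxA W) Wu mulmx0.
    by rewrite (mulmxA W S) -S2E yS2 row_mx0.
  have /(unitmx_row_eq0 Uu) : row_mx 0 y *m U = 0 by rewrite mul_row_col mul0mx add0r.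
  by rewrite -(@row_mx0 _ _ 1 n) => /eq_row_mx[].
have AS2 (y : 'rV_n) : (y *m (A2 *m S2 + S2 *m A2^t*) *m y^t*) 0 0 <= 0.
  have -> : A2 *m S2 + S2 *m A2^t* = W *m (A *m S + S *m A^t*) *m W^t*.
    have e1 : A2 *m S2 = W *m A *m S *m W^t*.
      by rewrite WA !mulmxDl -(mulmxA b) -(mulmxA b) vSW mulmx0 add0r S2E !mulmxA.
    have e2 : S2 *m A2^t* = W *m S *m A^t* *m W^t*.
      by rewrite -mulmxA WAc mulmxDr !mulmxA Wu mul0mx add0r -S2E.
    by rewrite e1 e2; mx_abel.
  by have := AS (y *m W); rewrite ctrM !mulmxA.
have A2ev c (y : 'rV_n) : y != 0 -> y *m A2 = c *: y -> 'Re c < 0.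
  move=> y0 yA2; have [-> //|ca] := eqVneq c a.
  (* [d] solves [d * a + (y *m b) 0 0 = c * d], so [z] is an eigenvector of [A] for [c]. *)
  pose d := (y *m b) 0 0 / (c - a).
  pose z : 'rV_n.+1 := d *: v + y *m W.
  apply: (Aev c z).
    apply: contra_neq y0 => z0.
    have /(unitmx_row_eq0 Uu) : row_mx d%:M y *m U = 0 by rewrite mul_row_col mul_scalar_mx.
    by rewrite -(@row_mx0 _ _ 1 n) => /eq_row_mx[].
  rewrite /z mulmxDl -scalemxAl vA -mulmxA WA mulmxDr !mulmxA yA2.
  rewrite (mx11_scalar (y *m b)) mul_scalar_mx addrA !scalerA -scalerDl scalerDr scalerA.
  rewrite -scalemxAl; congr (_ *: _ + _).
  have := ca; rewrite -subr_eq0 => ca0.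
  by rewrite /d; field.
have {}IH := IH A2 S2 S2h S2u AS2 A2ev.
have [d [y xE]] : exists d y, x = d *: v + y *m W.
  exists ((x *m L) 0 0), (x *m P).
  by rewrite -[LHS]mulmx1 -LP mulmxDr !mulmxA -mul_scalar_mx -mx11_scalar.
have -> : (x *m S *m x^t*) 0 0 = d * d^* * (v *m S *m v^t*) 0 0 + (y *m S2 *m y^t*) 0 0.
  rewrite xE ctrD ctrZ ctrM !mulmxDl !mulmxDr -!scalemxAl -!scalemxAr.
  rewrite !mulmxA vSW -(mulmxA y W S) -(mulmxA y (W *m S)) Wu !(mul0mx, mulmx0, scaler0).
  by rewrite addr0 add0r scalerA mxE [X in X + _]mxE S2E !mulmxA.
have [y0|y0] := eqVneq y 0.
  rewrite y0 !mul0mx [X in _ + X]mxE addr0 mulr_gt0 // mul_conjC_gt0.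
  by apply: contra_neq x0 => d0; rewrite xE y0 d0 scale0r mul0mx addr0.
by rewrite ltr_wpDl ?IH // mulr_ge0 ?mul_conjC_ge0 // ltW.
Qed.

End Lyapunov.

(** * Krylov iterates and the graph of the reachable space *)

Section Krylov.
Variable C : numClosedFieldType.

Lemma iter_mulmx_ctr n m p (A : 'M[C]_n) (M : 'M[C]_(m, n)) (N : 'M[C]_(n, p)) k :
  (M *m iter k (mulmx A) N)^t* = N^t* *m iter k (mulmx (A^t*)) (M^t*).
Proof.
elim: k N => [|k IH] N; first exact: ctrM.
by rewrite iterSr IH ctrM -mulmxA.
Qed.

Lemma iter_mulNmx n p (A : 'M[C]_n) (N : 'M[C]_(n, p)) k :
  iter k (mulmx (- A)) N = (-1) ^+ k *: iter k (mulmx A) N.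
Proof.
elim: k => [|k IH]; first by rewrite expr0 scale1r.
by rewrite !iterS IH mulNmx -scalemxAr exprS mulN1r scaleNr.
Qed.

Lemma iter_mulmxM n p q (A : 'M[C]_n) (N : 'M[C]_(n, p)) (W : 'M[C]_(p, q)) k :
  iter k (mulmx A) (N *m W) = iter k (mulmx A) N *m W.
Proof. by elim: k => // k IH; rewrite !iterS IH mulmxA. Qed.

Lemma usubmx_mul n r p (M : 'M[C]_(n + r, p)) : usubmx M = row_mx 1%:M 0 *m M.
Proof. by rewrite -{2}[M]vsubmxK mul_row_col mul1mx mul0mx addr0. Qed.

Lemma dsubmx_mul n r p (M : 'M[C]_(n + r, p)) : dsubmx M = row_mx 0 1%:M *m M.
Proof. by rewrite -{2}[M]vsubmxK mul_row_col mul1mx mul0mx add0r. Qed.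

(* The space reachable by the cascade [block_mx A 0 G E] is the graph of S:
   it projects onto the first factor because (A, B) is controllable, and
   injectively so because the zero response and the observability of (E, c2)
   leave nothing of the form (0, z) in it. *)
Lemma reachable_graph n r m p (A : 'M[C]_n) (B : 'M[C]_(n, m))
    (G : 'M[C]_(r, n)) (E : 'M[C]_r) (N : 'M[C]_(r, m))
    (c1 : 'M[C]_(p, n)) (c2 : 'M[C]_(p, r)) :
  controllable A B ->
  (forall q (V : 'M[C]_(r, q)), (forall k, c2 *m iter k (mulmx E) V = 0) -> V = 0) ->
  (forall k, row_mx c1 c2 *m iter k (mulmx (block_mx A 0 G E)) (col_mx B N) = 0) ->
  exists S : 'M[C]_(r, n), [/\ S *m B = N, S *m A = G + E *m S & c1 + c2 *m S = 0].
Proof.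
move=> ctAB obsE c0; set Z := block_mx A 0 G E.
pose v k := iter k (mulmx Z) (col_mx B N).
have [beta vE] : exists beta, forall k, v k = col_mx (iter k (mulmx A) B) (beta k).
  exists (fun k => dsubmx (v k)) => k; rewrite -[LHS]vsubmxK; congr col_mx.
  elim: k => [|k IH]; first by rewrite /v /= col_mxKu.
  by rewrite /v iterS -/(v k) -[v k]vsubmxK IH mul_block_col mul0mx addr0 col_mxKu.
have beta0 : beta 0%N = N by have := vE 0%N; rewrite /v /= => /eq_col_mx[].
have betaS k : beta k.+1 = G *m iter k (mulmx A) B + E *m beta k.
  by have := vE k.+1; rewrite /v iterS -/(v k) vE mul_block_col => /eq_col_mx[].
(* [n.+1] powers, one more than [controllable] asks for: the equation for [S *m A] uses [S] on the
   power [k.+1] for every [k < n]. *)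
pose Gam := \mxrow_(k < n.+1) iter k (mulmx A) B.
pose bet := \mxrow_(k < n.+1) beta k.
have KrE : col_mx Gam bet = \mxrow_(k < n.+1) v k.
  rewrite -[RHS]vsubmxK usubmx_mul dsubmx_mul !mul_mxrow.
  congr col_mx; apply: eq_mxrow => k; rewrite vE mul_row_col.
    by rewrite mul1mx mul0mx addr0.
  by rewrite mul1mx mul0mx add0r.
have Gfree : row_free Gam.
  apply: inj_row_free => w; rewrite mul_mxrow -mxrow0 => /eq_mxrowP wG.
  by apply: ctAB => k kn; apply: (wG (Ordinal (ltnW kn : (k < n.+1)%N))).
have ker q (W : 'M_(_, q)) : Gam *m W = 0 -> bet *m W = 0.
  move=> GW; apply: obsE => j.
  have -> : c2 *m iter j (mulmx E) (bet *m W) =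
      row_mx c1 c2 *m iter j (mulmx Z) (col_mx Gam bet *m W).
    have -> : iter j (mulmx Z) (col_mx Gam bet *m W) =
        col_mx 0 (iter j (mulmx E) (bet *m W)).
      elim: j => [|j IH]; first by rewrite mul_col_mx GW.
      by rewrite !iterS IH mul_block_col !mulmx0 mul0mx addr0 add0r.
    by rewrite mul_row_col mulmx0 add0r.
  rewrite KrE iter_mulmxM mulmxA.
  have -> : iter j (mulmx Z) (\mxrow_(k < n.+1) v k) = \mxrow_(k < n.+1) v (j + k)%N.
    elim: j => [|j IH]; first by apply: eq_mxrow.
    by rewrite iterS IH mul_mxrow; apply: eq_mxrow.
  rewrite mul_mxrow (_ : \mxrow_ _ _ = 0) ?mul0mx //.
  by rewrite -mxrow0; apply: eq_mxrow => k; apply: c0.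
have [Gi GGi] := row_freeP Gfree.
pose S := bet *m Gi.
(* [Gi] is a right inverse of [Gam], so [Gam] annihilates [1%:M - Gi *m Gam], and by [ker] so does
   [bet]. *)
have SG : S *m Gam = bet.
  apply/eqP; rewrite eq_sym -subr_eq0 /S -mulmxA -{1}[bet]mulmx1 -mulmxBr; apply/eqP.
  by apply: ker; rewrite mulmxBr mulmx1 mulmxA GGi mul1mx subrr.
have Sk k : (k < n.+1)%N -> S *m iter k (mulmx A) B = beta k.
  move=> kn; move: SG; rewrite mul_mxrow /bet => /eq_mxrowP/(_ (Ordinal kn)); exact.
exists S; split.
- by rewrite -beta0 -(Sk 0%N).
- apply/eqP; rewrite -subr_eq0; apply/eqP; apply: ctAB => k kn.
  rewrite mulmxBl -mulmxA -iterS Sk // betaS mulmxDl -mulmxA Sk ?subrr //.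
  exact: ltnW.
- apply: ctAB => k kn; rewrite mulmxDl -mulmxA Sk; last exact: ltnW.
  by rewrite -mul_row_col -vE; apply: c0.
Qed.

End Krylov.

(** * Eigenvalues of a minimal realization are poles *)

Section Regularity.
Variable C : numClosedFieldType.
Local Notation K := {fraction {poly C}}.

(** Replacing [B] by [A *m B - z *: B] multiplies the response by ['X - z] up to a constant, so a
    shorter list clears the denominators, and [w *m B] is multiplied by the nonzero [a - z]. For the
    empty list strict properness and observability give [B = 0]. *)
Lemma regular_eigenvector n m p (A : 'M[C]_n) (Cm : 'M[C]_(p, n)) (B : 'M[C]_(n, m))
    (s : seq C) a (w : 'rV[C]_n) (P : 'M[{poly C}]_(p, m)) :
  (forall q (V : 'M[C]_(n, q)), (forall k, Cm *m iter k (mulmx A) V = 0) -> V = 0) ->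
  a \notin s -> w *m A = a *: w ->
  tofrac (\prod_(z <- s) ('X - z%:P)) *: (cstm Cm *m resolvent A *m cstm B)
    = map_mx (@tofrac {poly C}) P ->
  w *m B = 0.
Proof.
move=> obs as_ wA; elim: s B P as_ => [|z s IH] B P.
  rewrite big_nil rmorph1 scale1r => _ e.
  have B0 : B = 0.
    by apply: obs => k; apply: resolvent_markov; rewrite e (resolvent_strictly_proper e) map_mx0.
  by rewrite B0 mulmx0.
rewrite inE negb_or => /andP[az as_] e; set g := \prod_(z <- s) _ in IH.
have wB' : w *m (A *m B - z *: B) = 0.
  apply: (IH _ (P - g *: map_mx polyC (Cm *m B)) as_).
  rewrite map_mxB -e big_cons map_mxZ -/g.
  have -> : map_mx (@tofrac {poly C}) (map_mx polyC (Cm *m B)) = cstm (Cm *m B).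
    exact: esym (map_mx_comp _ _ _).
  have -> : cstm (A *m B - z *: B) = cstm (A *m B) - tofrac z%:P *: cstm B.
    by rewrite cstmD cstmN -!mul_scalar_mx !cstmM cstm_scalar.
  rewrite mulmxBr resolvent_mulA -scalemxAr rmorphM rmorphB /= -/sK.
  by rewrite !scalerBr !scalerA mulrBl scalerBl -!(mulrC (tofrac g)) addrAC.
move: wB'; rewrite mulmxBr mulmxA wA -scalemxAl -scalemxAr -scalerBl => /eqP.
by rewrite scaler_eq0 subr_eq0 (negPf az) => /eqP.
Qed.

Lemma common_denominator p q (F : 'M[K]_(p, q)) s V : mxval F s V ->
  exists (d : {poly C}) (P : 'M[{poly C}]_(p, q)),
    d.[s] != 0 /\ tofrac d *: F = map_mx (@tofrac {poly C}) P.
Proof.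
move=> FV.
have /fin_all_exists[f fP] : forall ij : 'I_p * 'I_q, exists f : {poly C} * {poly C},
    f.2.[s] != 0 /\ F ij.1 ij.2 = tofrac f.1 / tofrac f.2.
  by move=> ij; have [a [b [bs e _]]] := FV ij.1 ij.2; exists (a, b).
exists (\prod_ij (f ij).2).
exists (\matrix_(i, j) ((f (i, j)).1 * \prod_(kl | kl != (i, j)) (f kl).2)); split.
  by rewrite horner_prod; apply/prodf_neq0 => ij _; have [] := fP ij.
apply/matrixP => i j; rewrite !mxE (bigD1 (i, j)) //=.
have [ds ->] := fP (i, j); have d0 := tofrac_neq0 ds.
rewrite !rmorphM /=; set x := tofrac _ in d0 *.
by rewrite mulrC mulrA divfK.
Qed.

(** A left eigenvector of [A] at a point where the function is regular would annihilate [B] by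
    [regular_eigenvector], against minimality. *)
Lemma minimal_regular n m (A : 'M[C]_n) B Cm (D : 'M[C]_m) s V :
  minimal_realization (block_mx A B Cm D) ->
  mxval (tf A B Cm D) s V -> s%:M - A \in unitmx.
Proof.
move=> Rmin /common_denominator[d [P [ds dF]]].
rewrite unitmxE unitfE; apply/negP => /det0P[w w0].
rewrite mulmxBr mul_mx_scalar => /eqP; rewrite subr_eq0 eq_sym => /eqP wA.
case/eqP: w0; apply: (minimal_left_eigenvector Rmin wA).
have d0 : d != 0 by apply: contraNneq ds => ->; rewrite horner0.
have [r dE] := closed_field_poly_normal d.
have l0 : lead_coef d != 0 by rewrite lead_coef_eq0.
have gE : \prod_(z <- r) ('X - z%:P) = (lead_coef d)^-1 *: d.
  by have := congr1 ( *:%R (lead_coef d)^-1) dE; rewrite scalerA mulVf // scale1r.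
(* [D] is subtracted to leave the strictly proper part, and the leading coefficient is divided out
   to leave a product of monic factors. *)
apply: (regular_eigenvector (s := r) (Cm := Cm)
  (P := (lead_coef d)^-1%:P *: (P - d *: map_mx polyC D)) _ _ wA).
- by move=> q W; apply: minimal_observable Rmin.
- by rewrite -root_prod_XsubC gE rootZ ?invr_neq0.
- rewrite gE map_mxZ map_mxB -dF map_mxZ.
  have -> : map_mx (@tofrac {poly C}) (map_mx polyC D) = cstm D.
    exact: esym (map_mx_comp _ _ _).
  by rewrite -scalerBr /tf addrK scalerA -rmorphM mul_polyC.
Qed.

End Regularity.

(** * Necessity of the matrix equation for a minimal realization *)

Section Converse.
Variables (C : numClosedFieldType) (n m : nat).
Variables (A : 'M[C]_n) (B : 'M[C]_(n, m)) (Cm : 'M[C]_(m, n)) (D T : 'M[C]_m).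
Hypothesis Rmin : minimal_realization (block_mx A B Cm D).
Hypothesis T0 : psdmx T.
Hypothesis canF : canonical_HP T (tf A B Cm D).

Let Th : T^t* = T. Proof. by case: T0 => /hermsymmxP. Qed.

(** [G] and [N] are the right-hand sides of the first two equations of [kyp]. A matrix [S] solves
    these exactly when its graph is [Z]-invariant and contains the columns of [b]; [c] vanishes on
    the graph when [B^t* *m S = Cm - D^t* *m T *m Cm]. *)
Let G : 'M[C]_n := - (Cm^t* *m T *m Cm).
Let N : 'M[C]_(n, m) := Cm^t* - Cm^t* *m T *m D.
Let Z : 'M[C]_(n + n) := block_mx A 0 G (- A^t*).
Let b : 'M[C]_(n + n, m) := col_mx B N.
Let c : 'M[C]_(m, n + n) := row_mx (- (Cm - D^t* *m T *m Cm)) (B^t*).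

(* With [F~ s = F (- s^* )^*], this transfer function is the strictly proper part
   of [F~ T F - F - F~ + T], a function that vanishes on the imaginary axis. *)
Lemma cascade_transfer :
  cstm c *m resolvent Z *m cstm b = cstm (D + D^t* - (T + D^t* *m T *m D)).
Proof.
set P := D + _ - _; apply/eqP; rewrite -subr_eq0; apply/eqP.
have d0 : char_poly A * char_poly Z != 0 by rewrite mulf_neq0 ?char_poly_neq0.
apply: (axis_matrix_eq0 d0) => s s0; rewrite hornerM mulf_eq0 negb_or -!unitmx_char_poly.
move=> /andP[Au Zu]; pose X := invmx (s%:M - A) *m B; pose V := Cm *m X + D.
have FV : mxval (tf A B Cm D) s V by rewrite /V /X mulmxA; apply: mxval_tf.
have VP : V + V^t* - (T + V^t* *m T *m V) = 0 by apply: (canF.2 s).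
have sN : s^* = - s by apply/eqP; rewrite -addr_eq0 addrC addCJ s0 mul0rn.
(* As [s] is minus its conjugate on the axis, [Y] inverts [s%:M + A^t*], the lower diagonal block of
   [s%:M - Z]. *)
pose Y := - (invmx (s%:M - A))^t*.
have AY : (s%:M + A^t*) *m Y = 1%:M.
  have -> : s%:M + A^t* = - (s%:M - A)^t*.
    by rewrite !ctrE sN opprB raddfN /= opprK addrC.
  by rewrite mulNmx mulmxN opprK -ctrM mulVmx // ctr1.
have BY : B^t* *m Y = - X^t* by rewrite /X /Y mulmxN ctrM.
pose z := Y *m (G *m X + N).
have ZXz : invmx (s%:M - Z) *m b = col_mx X z.
  apply: (canLR (mulKmx Zu)); rewrite scalar_mx_block opp_block_mx add_block_mx.
  rewrite mul_block_col oppr0 addr0 mul0mx addr0 sub0r (opprK (A^t*)) mulKVmx //.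
  by rewrite /z [_ *m (Y *m _)]mulmxA AY mul1mx mulNmx addKr.
have <- : c *m invmx (s%:M - Z) *m b - P = 0.
  rewrite -mulmxA ZXz mul_row_col /z mulmxA BY.
  apply/eqP; rewrite -oppr_eq0 -VP; apply/eqP; rewrite /P /V /G /N !ctrE; mx_abel.
apply: mxvalD (mxvalN (mxval_cst _ _)).
exact: mxvalM (mxvalM (mxval_cst _ _) (mxval_resolvent Zu)) (mxval_cst _ _).
Qed.

Lemma exists_hermitian_solution : exists S : 'M[C]_n,
  [/\ S^t* = S, kyp A B Cm D T S & B^t* *m S = Cm - D^t* *m T *m Cm].
Proof.
(* A strictly proper function that is constant vanishes, so both the third equation of [kyp] and the
   zero response follow. *)
have P0 := resolvent_strictly_proper_cst cascade_transfer.
have cZb : cstm c *m resolvent Z *m cstm b = 0 by rewrite cascade_transfer P0 cstm0.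
have ctAB := minimal_controllable Rmin.
have obsA q (V : 'M[C]_(n, q)) :
    (forall k, B^t* *m iter k (mulmx (- A^t*)) V = 0) -> V = 0.
  move=> BV; apply/eqP; rewrite -ctr_eq0; apply/eqP; apply: ctAB => k _.
  rewrite -[LHS]trmxCK iter_mulmx_ctr trmxCK; have := BV k; rewrite iter_mulNmx.
  move/eqP; rewrite -scalemxAr scaler_eq0 signr_eq0 /= => /eqP ->.
  by rewrite ctr0.
have [S [SB SA cS]] := reachable_graph ctAB obsA (fun k => resolvent_markov k cZb).
have BS : B^t* *m S = Cm - D^t* *m T *m Cm.
  by apply/eqP; rewrite -subr_eq0 addrC cS.
have D2 : D + D^t* = T + D^t* *m T *m D by apply/eqP; rewrite -subr_eq0 P0.
have Sc : S^t* *m B = N.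
  by have := congr1 (fun M => M^t*) BS; rewrite !ctrE Th => ->; rewrite mulmxA.
have ScA : S^t* *m A = G - A^t* *m S^t*.
  have := congr1 (fun M => M^t*) SA; rewrite /G !ctrE Th => e.
  by rewrite e /G; mx_abel.
(* [S - S^t*] annihilates [B], and multiplying it by [A] on the right equals multiplying it by
   [- A^t*] on the left, so it annihilates every [A ^ k B]. *)
have Sh : S^t* = S.
  apply/eqP; rewrite eq_sym -subr_eq0; apply/eqP; apply: ctAB => k _.
  elim: k => [|k IH]; first by rewrite mulmxBl SB Sc subrr.
  rewrite iterS mulmxA mulmxBl SA ScA.
  have -> : G + - A^t* *m S - (G - A^t* *m S^t*) = - A^t* *m (S - S^t*) by mx_abel.
  by rewrite -mulmxA IH mulmx0.
exists S; split=> //; split=> //.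
by rewrite SA mulNmx subrK.
Qed.

(** The kernel of [S] is [A]-invariant and contained in the kernel of [Cm], hence zero by
    observability. *)
Lemma solution_unitmx (S : 'M[C]_n) : S^t* = S -> kyp A B Cm D T S ->
  B^t* *m S = Cm - D^t* *m T *m Cm -> S \in unitmx.
Proof.
move=> Sh [SA _ _] BS; apply/negPn/negP => /non_unitmx_ker[x x0 Sx].
have inv (y : 'cV_n) : S *m y = 0 -> S *m (A *m y) = 0 /\ Cm *m y = 0.
  move=> Sy; have yS : y^t* *m S = 0 by rewrite -Sh -ctrM Sy ctr0.
  have TCy : T *m (Cm *m y) = 0.
    apply: psdmx_kernel => //; rewrite ctrM.
    have -> : y^t* *m Cm^t* *m T *m (Cm *m y) = - (y^t* *m (S *m A + A^t* *m S) *m y).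
      by rewrite SA; mx_abel.
    by rewrite mulmxDr mulmxDl mulmxA yS -!mulmxA Sy !(mulmx0, mul0mx) addr0 oppr0 mxE.
  split.
    have := congr1 (fun M => M *m y) SA; rewrite mulmxDl -!mulmxA Sy mulmx0 addr0 => ->.
    by rewrite mulNmx -!mulmxA TCy mulmx0 oppr0.
  have := congr1 (fun M => M *m y) BS; rewrite mulmxBl -!mulmxA Sy TCy !mulmx0 subr0.
  by move=> <-.
have Sk k : S *m iter k (mulmx A) x = 0 by elim: k => // k /inv[].
move: x0; rewrite (@minimal_observable _ _ _ _ _ _ _ _ x Rmin) ?eqxx // => k.
by have [] := inv _ (Sk k).
Qed.

(** At such an [x] the form equals minus twice the sum of the squared norm of [x] and the form of
    [T] at [x]. *)
Lemma passive_ker (V : 'M[C]_m) (x : 'cV[C]_m) :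
  psdmx (V + V^t* - (T + V^t* *m T *m V)) -> V *m x = - x -> x = 0.
Proof.
move=> [_ V0] Vx; have xV : x^t* *m V^t* = - x^t* by rewrite -ctrM Vx ctrN.
have := V0 x.
have -> : x^t* *m (V + V^t* - (T + V^t* *m T *m V)) *m x
    = - ((x^t* *m x + x^t* *m T *m x) *+ 2).
  have -> : x^t* *m (V + V^t* - (T + V^t* *m T *m V)) *m x =
    x^t* *m (V *m x) + (x^t* *m V^t*) *m x - x^t* *m T *m x
      - (x^t* *m V^t*) *m T *m (V *m x) by mx_abel.
  by rewrite Vx xV; mx_abel.
rewrite mxE oppr_ge0 mulmxnE pmulrn_lle0 // mxE => le0.
have xx := dotmx_ge0 (x^t*); rewrite trmxCK in xx.
have xT := T0.2 x.
suff : x^t* = 0 by move/eqP; rewrite ctr_eq0 => /eqP.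
apply: dotmx_eq0; rewrite trmxCK; apply/eqP; rewrite eq_le xx andbT.
by apply: le_trans le0; rewrite lerDl.
Qed.

Lemma solution_pdmx (S : 'M[C]_n) : S^t* = S -> kyp A B Cm D T S ->
  B^t* *m S = Cm - D^t* *m T *m Cm -> pdmx S.
Proof.
move=> Sh eqs BS; have Su := solution_unitmx Sh eqs BS.
case: eqs => SA SB DD.
(* [D], the value of the function at infinity, satisfies the passivity inequality with equality. *)
have Du : 1%:M + D \in unitmx.
  apply/negPn/negP => /non_unitmx_ker[x x0].
  rewrite mulmxDl mul1mx => /eqP; rewrite addrC addr_eq0 => /eqP Dx; case/eqP: x0.
  apply: passive_ker Dx; rewrite DD subrr -(scale0r 1%:M).
  by apply: psdmxZ (psdmx1 _ _).
pose L := invmx (1%:M + D) *m Cm.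
have CL : Cm = L + D *m L by rewrite -{1}(mul1mx L) -mulmxDl mulKVmx.
clearbody L.
pose A' := A - B *m L.
have SA' : S *m A' + A'^t* *m S = - ((L^t* *m (1%:M + T) *m L) *+ 2).
  have -> : S *m A' + A'^t* *m S =
      (S *m A + A^t* *m S) - (S *m B) *m L - L^t* *m (B^t* *m S).
    by rewrite /A' !ctrE; mx_abel.
  rewrite SA SB BS CL !ctrE; clear -DD.
  have -> : L^t* *m (1%:M + T) *m L *+ 2 =
      L^t* *m L *+ 2 + L^t* *m T *m L + L^t* *m (D + D^t* - D^t* *m T *m D) *m L.
    by rewrite DD addrK; mx_abel.
  by mx_abel.
have posL (x : 'cV_n) : 0 <= ((L *m x)^t* *m (1%:M + T) *m (L *m x)) 0 0.
  exact: (psdmxD (psdmx1 _ _) T0).2.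
have form (x : 'cV_n) : x^t* *m (S *m A' + A'^t* *m S) *m x
    = - (((L *m x)^t* *m (1%:M + T) *m (L *m x)) *+ 2) by rewrite SA' ctrM; mx_abel.
have A'ev a (v : 'cV_n) : v != 0 -> A' *m v = a *: v -> 'Re a < 0.
  move=> v0 A'v; have Av : A *m v = a *: v + B *m (L *m v).
    by rewrite -A'v /A' mulmxBl -mulmxA subrK.
  have Lv0 : L *m v = 0 -> False.
    move=> Lv; case/eqP: v0; apply: (minimal_right_eigenvector Rmin (a := a)).
      by rewrite Av Lv mulmx0 addr0.
    by rewrite CL mulmxDl -mulmxA Lv mulmx0 addr0.
  (* On the axis the closed-loop Lyapunov form vanishes at [v], which forces [L *m v = 0]. To the
     right of it the value [V] at [a] sends [- (L *m v)] to its opposite, and [passive_ker] gives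
     the same. *)
  rewrite real_ltNge ?real0 ?Creal_Re //; apply/negP; rewrite le_eqVlt => /orP[/eqP|] a0.
    apply: Lv0; have := form v; rewrite mulmxDr mulmxDl !mulmxA -(mulmxA (_ *m S)) A'v.
    have -> : v^t* *m A'^t* = a^* *: v^t* by rewrite -ctrM A'v ctrZ.
    rewrite -!scalemxAl -scalemxAr -scalerDl addCJ -a0 mul0rn scale0r => /matrixP/(_ 0 0).
    rewrite mxE [RHS]mxE mulmxnE => /esym/eqP; rewrite oppr_eq0 mulrn_eq0 /= => /eqP e.
    have [_ T1] := T0; have := T1 (L *m v) => T1v.
    have Lv1 := dotmx_ge0 ((L *m v)^t*); rewrite trmxCK in Lv1.
    move: e; rewrite -(mulmxA _ L v) mulmxDr mulmx1 mulmxDl [LHS]mxE => /eqP; rewrite paddr_eq0 // => /andP[/eqP e _].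
    by apply/eqP; rewrite -ctr_eq0; apply/eqP/dotmx_eq0; rewrite trmxCK.
  have [V FV VP] := canF.1 a a0; have u := minimal_regular Rmin FV.
  have VE := mxval_uniq FV (mxval_tf B Cm D u).
  apply: Lv0; apply/eqP; rewrite -oppr_eq0; apply/eqP.
  apply: (passive_ker VP); rewrite opprK VE mulmxDl -!mulmxA.
  have -> : B *m - (L *m v) = (a%:M - A) *m v.
    by rewrite mulmxBl mul_scalar_mx Av opprD addrA subrr sub0r mulmxN.
  by rewrite mulKmx // CL mulmxN mulmxDl -mulmxA addrK.
split; first exact/hermsymmxP.
(* [lyapunov_pos] speaks of row vectors, so it is applied to the adjoint of [A']. *)
have nsd (y : 'rV_n) : (y *m (A'^t* *m S + S *m A'^t*^t*) *m y^t*) 0 0 <= 0.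
  have := form (y^t*); rewrite !trmxCK addrC => ->.
  by rewrite mxE oppr_le0 mulmxnE mulrn_wge0.
have hurwitz a (y : 'rV_n) : y != 0 -> y *m A'^t* = a *: y -> 'Re a < 0.
  move=> y0 yA; rewrite -Re_conj; apply: (A'ev _ (y^t*)); first by rewrite ctr_eq0.
  by rewrite -[LHS]trmxCK ctrM trmxCK yA ctrZ.
move=> x x0; have := lyapunov_pos Sh Su nsd hurwitz (x := x^t*).
by rewrite trmxCK ctr_eq0; apply.
Qed.

Lemma canonical_kyp : exists2 H : 'M[C]_n, pdmx H & kyp A B Cm D T H.
Proof.
have [S [Sh eqs BS]] := exists_hermitian_solution.
by exists S => //; apply: solution_pdmx.
Qed.

End Converse.

Theorem theorem1p10 (R : realType) (n m : nat)
    (A : 'M[R[i]]_n) (B : 'M[R[i]]_(n, m))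
    (C : 'M[R[i]]_(m, n)) (D : 'M[R[i]]_m)
    (RF : 'M[R[i]]_(n + m)) (F : 'M[{fraction {poly R[i]}}]_m) :
  RF = block_mx A B C D ->
  F = transfer RF ->
  forall T : 'M[R[i]]_m,
    loewner_gt 1%:M T -> loewner_ge T 0 -> (1 <= \rank T)%N ->
    [/\ (exists2 H : 'M[R[i]]_n, pdmx H & KYP_eq T H RF) -> canonical_HP T F,
        minimal_realization RF -> canonical_HP T F ->
          exists2 H : 'M[R[i]]_n, pdmx H & KYP_eq T H RF
      & RF \in unitmx ->
        (exists2 H : 'M[R[i]]_n, pdmx H & KYP_eq T H RF) ->
          canonical_HP T (transfer (invmx RF)) ].
Proof.
move=> RFE FE T _; rewrite /loewner_ge subr0 => T0 _.
have Th : T^t* = T by case: T0 => /hermsymmxP.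
split.
- by rewrite FE => -[H Hpos eqs]; apply: KYP_canonical Hpos T0 eqs.
- rewrite FE RFE transferE => Rmin canF.
  have [H Hpos eqs] := canonical_kyp Rmin T0 canF.
  by exists H => //; apply/KYP_eqP => //; case: Hpos => /hermsymmxP.
- move=> RFu [H Hpos eqs].
  exact: KYP_canonical Hpos T0 (KYP_eq_inv RFu eqs).
Qed.
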